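(* Let $\{X, X_{k,i};\ i \geq 1, k \geq 1\}$ be a double array of i.i.d. real-valued random variables with $\mathbb{E}X^2 = 1$. Then, for any given constant $0 < a < \infty$, $$n\,\mathbb{P}\left( n^{1/4} \frac{\max_{1 \leq j \leq n} |X_{j,1} X_{j,2}|}{\sqrt{\sum_{k=1}^{n} X_{k,1}^2}\,\sqrt{\sum_{k=1}^{n} X_{k,2}^2}} > a \right) = O(1) \quad \text{as } n \to \infty$$ if and only if $$n^2\,\mathbb{P}\left( n^{1/4} \frac{|X_{1,1} X_{1,2}|}{\sqrt{\sum_{k=1}^{n} X_{k,1}^2}\,\sqrt{\sum_{k=1}^{n} X_{k,2}^2}} > a \right) = O(1) \quad \text{as } n \to \infty.$$
   Context: A ratio whose denominator vanishes is taken to be $0$. *)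

(* Defs.v *)
From HB Require Import structures.
From mathcomp Require Import all_boot all_order all_algebra finmap.
From mathcomp Require Import all_classical all_reals all_analysis.
Set Implicit Arguments.
Unset Strict Implicit.
Unset Printing Implicit Defensive.
Import Order.TTheory GRing.Theory Num.Theory.
Import numFieldNormedType.Exports.
Local Open Scope classical_set_scope.
Local Open Scope ring_scope.

(* Mutual independence of the subfamily (X i), i in D: the product rule over
   every finite subset of D. *)
Definition mutually_independent (I : choiceType) (D : set I)
    (d d' : measure_display) (T : measurableType d) (T' : measurableType d')
    (R : realType) (P : probability T R) (X : I -> {RV P >-> T'}) : Prop :=
  forall (J : {fset I}) (A : I -> set T'),
    [set` J] `<=` D ->
    (forall i, i \in J -> measurable (A i)) ->
    P (\bigcap_(i in [set` J]) (X i @^-1` A i)) =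
      (\prod_(i <- J) P (X i @^-1` A i))%E.

Definition identically_distributed
    (d d' : measure_display) (T : measurableType d) (T' : measurableType d')
    (R : realType) (P : probability T R) (X Y : {RV P >-> T'}) : Prop :=
  forall A : set T', measurable A -> distribution P X A = distribution P Y A.

(* Main.v *)
Require Import Defs.
From HB Require Import structures.
From mathcomp Require Import all_boot all_order all_algebra finmap.
From mathcomp Require Import all_classical all_reals all_analysis.
From mathcomp Require Import measurable_realfun ring lra.
Import Order.TTheory GRing.Theory Num.Theory.
Import numFieldNormedType.Exports.
Local Open Scope classical_set_scope.
Local Open Scope ring_scope.
Set Implicit Arguments.
Unset Strict Implicit.
Unset Printing Implicit Defensive.

(* Write A_j for the event that the j-th self-normalized product exceeds a.  By
   exchangeability P(A_j) = P(A_1), so the union bound gives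
   n P(max) <= n^2 P(A_1).  Conversely, the second Bonferroni inequality gives
   n P(A_1) <= P(max) + n^2 max_{i<j} P(A_i /\ A_j), and it suffices that
   P(A_i /\ A_j) = O(n^-3).  A Chernoff bound shows that each of the two sums of
   squares is at least c n outside an event of probability e^{-cn}, where
   e^{-2c} bounds E[exp(-X^2)] < 1; on the complement, A_i and A_j force
   X_{i,1}^2 X_{i,2}^2 X_{j,1}^2 X_{j,2}^2 >= (a c)^4 n^3, a product of four
   independent variables of mean 1, and Markov's inequality concludes. *)

(** * Generators of a product sigma-algebra *)

(* [measurable_prod_g_measurableTypeR] assumes [setT `<=` C], that is, that
   every set is in [C]; only [C setT] is needed. *)
Lemma measurable_prod_generated d (T1 : measurableType d) (T2 : pointedType)
    (C : set (set T2)) : C setT ->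
  @measurable _ (T1 * g_sigma_algebraType C)%type =
  <<s [set A `*` B | A in measurable & B in C] >>.
Proof.
move=> CT; set G := [set A `*` B | A in _ & B in _].
rewrite measurable_prod_measurableType; apply/seteqP; split; last first.
  apply: smallest_sub; first exact: smallest_sigma_algebra.
  move=> _ [A mA [B CB <-]]; apply: sub_sigma_algebra; exists A => //.
  by exists B => //; exact: sub_sigma_algebra.
apply: smallest_sub; first exact: smallest_sigma_algebra.
(* For the reverse inclusion it is enough that both projections are measurable for the sigma-algebra
   of rectangles; [C setT] makes [A] times the whole space a generator. *)
have m1 : measurable_fun setT (fst : g_sigma_algebraType G -> T1).
  move=> _ A mA; rewrite setTI; apply: sub_sigma_algebra.
  by exists A => //; exists setT => //; rewrite -[RHS]setIT; apply/seteqP; split.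
have m2 : measurable_fun setT
    (snd : g_sigma_algebraType G -> g_sigma_algebraType C).
  apply: (@measurability _ _ _ (g_sigma_algebraType C) _ _ C) => //.
  move=> _ [B CB <-]; rewrite setTI.
  by apply: sub_sigma_algebra; exists setT => //; exists B => //;
    apply/seteqP; split => [? []|].
move=> _ [A mA [B mB <-]].
rewrite (_ : _ `*` _ = fst @^-1` A `&` snd @^-1` B)//.
by apply: (@measurableI _ (g_sigma_algebraType G));
  rewrite -[X in measurable X]setTI; [exact: m1|exact: m2].
Qed.

(** * Joint distributions and exchangeability *)

Section cylinders.
Context {R : realType} {I : choiceType} (s : seq I).

(* Only the coordinates listed in [s] are constrained, so the generated
   sigma-algebra is that of the product over [s]. *)
Definition cylinders : set (set (I -> R)) :=
  [set B | exists A : I -> set R, (forall i, measurable (A i)) /\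
     B = [set x | forall i, i \in s -> A i (x i)]].

Local Notation cylinder_space := (g_sigma_algebraType cylinders).

Lemma cylinders_setI : setI_closed cylinders.
Proof.
move=> _ _ [A [mA ->]] [B [mB ->]].
exists (fun i => A i `&` B i); split; first by move=> i; exact: measurableI.
apply/seteqP; split => [x [xA xB] i si|x xAB]; first by split; [exact: xA|exact: xB].
by split => i /xAB [].
Qed.

Lemma cylindersT : cylinders setT.
Proof.
by exists (fun=> setT); split => //; apply/seteqP; split.
Qed.

Lemma measurable_coord i : i \in s ->
  measurable_fun setT (fun x : cylinder_space => x i).
Proof.
move=> si _ A mA; rewrite setTI; apply: sub_sigma_algebra.
exists (fun j => if j == i then A else setT); split.
  by move=> j; case: ifP.
apply/seteqP; split => [x Ax j sj|x /(_ _ si)]; last by rewrite eqxx.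
by case: eqP => // ->.
Qed.

Lemma measurable_to_cylinder_space d (T : measurableType d)
    (Y : I -> {mfun T >-> R}) :
  measurable_fun setT (fun w => (fun i => Y i w) : cylinder_space).
Proof.
apply: (@measurability _ _ _ cylinder_space _ _ cylinders) => //.
move=> _ [_ [A [mA ->]] <-]; rewrite setTI.
rewrite [X in measurable X](_ : _ = \bigcap_(i in [set` s]) (Y i @^-1` A i)).
  apply: fin_bigcap_measurable; first exact: finite_seq.
  by move=> i _; exact: measurable_funPTI.
by apply/seteqP; split => w Yw i; exact: Yw.
Qed.

End cylinders.

(** * Integrals of products of independent variables *)

Section independence.
Context {R : realType} {I : choiceType} {d : measure_display}
  {T : measurableType d} (P : probability T R) (D : set I)
  (Y : I -> {RV P >-> R}).
Hypothesis indY : mutually_independent D Y.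

Lemma mutually_independent_seq (s : seq I) (A : I -> set R) : uniq s ->
  [set` s] `<=` D -> (forall i, measurable (A i)) ->
  P [set w | forall i, i \in s -> A i (Y i w)] =
  (\prod_(i <- s) P (Y i @^-1` A i))%E.
Proof.
move=> us sD mA; pose J := [fset i in s]%fset.
have JE i : (i \in J) = (i \in s) by rewrite inE.
rewrite [LHS](_ : _ = P (\bigcap_(i in [set` J]) (Y i @^-1` A i))).
  rewrite (indY (A:=A))//; last by move=> i /=; rewrite JE => /sD.
  by apply: perm_big; apply: uniq_perm => //; exact: fset_uniq.
by congr (P _); apply/seteqP; split => w Yw i iJ; apply: Yw; move: iJ;
  rewrite /= JE.
Qed.

Local Notation cspace s := (g_sigma_algebraType (@cylinders R I s)).

(** Induction on [s]: the head variable is independent of the vector of the remaining ones, so their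
    joint law is a product measure and Tonelli splits off one factor. *)
Lemma ge0_integral_prod_independent (f : I -> R -> R) (s : seq I) :
  (forall i, measurable_fun setT (f i)) -> (forall i x, 0 <= f i x) ->
  uniq s -> [set` s] `<=` D ->
  (\int[P]_w (\prod_(i <- s) f i (Y i w))%:E =
   \prod_(i <- s) \int[P]_w (f i (Y i w))%:E)%E.
Proof.
move=> mf f0; elim: s => [_ _|i s IH /= /andP[si us] sD].
  by under eq_integral do rewrite big_nil; rewrite big_nil integral_cst// mul1e;
    exact: probability_setT.
have sD' : [set` s] `<=` D by move=> j js; apply: sD; rewrite /= inE js orbT.
pose Z w : cspace s := fun j => Y j w.
have mZ : measurable_fun setT Z by exact: measurable_to_cylinder_space.
pose W w : R * cspace s := (Y i w, Z w).
have mW : measurable_fun setT W by apply: measurable_fun_pair.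
pose Zm : {RV P >-> cspace s} := HB.pack Z (isMeasurableFun.Build _ _ _ _ Z mZ).
pose Wm : {RV P >-> (R * cspace s)%type} :=
  HB.pack W (isMeasurableFun.Build _ _ _ _ W mW).
pose g (z : cspace s) := \prod_(j <- s) f j (z j).
have mg : measurable_fun setT g.
  apply: measurable_prod => j js; apply: measurableT_comp => //.
  exact: measurable_coord.
have g0 z : 0 <= g z by apply: prodr_ge0.
(* Rectangles with a cylinder as second side form a pi-system generating the product sigma-algebra,
   so agreement there determines both finite measures. *)
have joint B : measurable B ->
    distribution P Wm B = (distribution P (Y i) \x distribution P Zm)%E B.
  apply: (@measure_unique _ R (R * cspace s)%type
    [set A `*` B | A in @measurable _ R & B in @cylinders R I s] (fun=> setT)
    _ _ _ _ (distribution P Wm) (distribution P (Y i) \x distribution P Zm)%E).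
  - by apply: measurable_prod_generated; exact: cylindersT.
  - move=> _ _ [A1 mA1 [B1 cB1 <-]] [A2 mA2 [B2 cB2 <-]].
    exists (A1 `&` A2); first exact: measurableI.
    by exists (B1 `&` B2); [exact: cylinders_setI|rewrite setXI].
  - by move=> _; exists setT => //; exists setT; [exact: cylindersT|rewrite setXTT].
  - by apply/seteqP; split => // x _; exists 0%N.
  - move=> _ [A mA [B' cB' <-]].
    transitivity (distribution P (Y i) A * distribution P Zm B')%E; last first.
      by apply/esym/product_measure1E => //; exact: sub_sigma_algebra.
    have [C [mC B'E]] := cB'.
    (* Since [i] is not in [s], placing [A] at coordinate [i] leaves the constraints of the cylinder
       intact. *)
    pose C' j := if j == i then A else C j.
    have mC' j : measurable (C' j) by rewrite /C'; case: ifP.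
    have := mutually_independent_seq (s := i :: s) (A := C').
    rewrite big_cons /C' eqxx => /(_ _ sD mC').
    rewrite /= si us => /(_ isT) H.
    transitivity (P [set w | forall j, j \in i :: s -> C' j (Y j w)]).
      congr (P _); apply/seteqP; split => [w [/= Aw Bw] j|w Cw].
        rewrite inE /C'; case: eqP => [->//|_ /= js].
        by move: Bw; rewrite B'E; apply.
      split => /=; first by move: (Cw i); rewrite inE eqxx /C' eqxx; apply.
      rewrite B'E => j js; move: (Cw j); rewrite inE js orbT /C'.
      by case: eqP js si => [-> ->//|_ js _]; apply.
    rewrite H; congr (_ * _)%E.
    transitivity (P [set w | forall j, j \in s -> C j (Y j w)]).
      rewrite mutually_independent_seq//; apply: eq_big_seq => j js.
      by case: eqP js si => [-> ->//|].
    by congr (P _); rewrite /distribution /pushforward B'E.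
  - by move=> _; rewrite -ge0_fin_numE//; exact: fin_num_measure.
pose h (u : R * cspace s) : \bar R := (f i u.1 * g u.2)%:E.
have h0 u : (0 <= h u)%E by rewrite lee_fin mulr_ge0.
have -> : (\int[P]_w (\prod_(j <- i :: s) f j (Y j w))%:E =
    \int[P]_w (h \o W) w)%E.
  by apply: eq_integral => w _; rewrite big_cons.
have mh : measurable_fun [set: R * cspace s] h.
  apply/measurable_EFinP; apply: measurable_funM.
    exact: (measurableT_comp (mf i)).
  exact: (measurableT_comp mg).
rewrite -(@ge0_integral_distribution _ _ _ _ _ P Wm)//.
rewrite (eq_measure_integral (distribution P (Y i) \x distribution P Zm)%E); last first.
  by move=> A mA _; exact: joint.
rewrite fubini_tonelli1//.
rewrite /fubini_F /h big_cons -IH//=.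
under eq_integral => x _.
  under eq_integral do rewrite EFinM.
  rewrite ge0_integralZl//; [|exact/measurable_EFinP|by move=> z _; rewrite lee_fin|
    by rewrite lee_fin].
  over.
rewrite ge0_integralZr//; [|exact/measurable_EFinP|by move=> z _; rewrite lee_fin|
    by apply: integral_ge0 => z _; rewrite lee_fin].
rewrite !ge0_integral_distribution//.
- exact/measurable_EFinP.
- exact/measurable_EFinP.
- by move=> y; rewrite lee_fin.
Qed.

End independence.

(** * Reindexing and equality of joint laws *)

Section exchangeability.
Context {R : realType} {I : choiceType} {d : measure_display}
  {T : measurableType d} (P : probability T R) (D : set I).

(** The product rule for [J] is the rule for its image under [tau] with the sets relabelled; as
    [tau] is its own inverse, image and preimage coincide. *)
Lemma mutually_independent_comp_involutive (Y : I -> {RV P >-> R})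
    (tau : I -> I) :
  involutive tau -> (forall i, D i -> D (tau i)) ->
  mutually_independent D Y -> mutually_independent D (Y \o tau).
Proof.
move=> tauK tauD indY J A JD mA.
pose J' := [fset tau i | i in J]%fset.
have J'E j : (j \in J') = (tau j \in J).
  apply/imfsetP/idP => /= [[i iJ ->]|jJ]; first by rewrite tauK.
  by exists (tau j); rewrite ?tauK.
have J'D : [set` J'] `<=` D by move=> j /=; rewrite J'E => /JD /tauD; rewrite tauK.
have mA' j : j \in J' -> measurable ((A \o tau) j) by rewrite J'E; exact: mA.
transitivity (\prod_(j <- J') P (Y j @^-1` (A \o tau) j))%E; last first.
  rewrite big_imfset/=; last by move=> i j _ _; exact: (can_inj tauK).
  by apply: eq_bigr => i _; rewrite tauK.
rewrite -indY//.
congr (P _); apply/seteqP; split => w /= Yw i /= iJ.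
  by have := Yw (tau i); rewrite /= tauK; apply; rewrite -J'E.
by have := Yw (tau i); rewrite /= tauK; apply; rewrite J'E tauK.
Qed.

(** Independence turns the probability of a cylinder into a product of marginals. Both laws
    therefore agree on a generating pi-system, hence everywhere. *)
Lemma eq_joint_distribution (Y Y' : I -> {RV P >-> R}) (s : seq I)
    (B : set (g_sigma_algebraType (@cylinders R I s))) :
  mutually_independent D Y -> mutually_independent D Y' ->
  (forall i A, D i -> measurable A -> P (Y i @^-1` A) = P (Y' i @^-1` A)) ->
  uniq s -> [set` s] `<=` D -> measurable B ->
  P [set w | B (fun i => Y i w)] = P [set w | B (fun i => Y' i w)].
Proof.
move=> indY indY' YY' us sD mB.
pose cspace := g_sigma_algebraType (@cylinders R I s).
pose joint (V : I -> {RV P >-> R}) : {RV P >-> cspace} :=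
  HB.pack (fun w => (fun i => V i w) : cspace)
    (isMeasurableFun.Build _ _ _ _ _ (@measurable_to_cylinder_space _ _ s _ _ V)).
apply: (@measure_unique _ R cspace (@cylinders R I s) (fun=> setT) _ _ _ _
  (distribution P (joint Y)) (distribution P (joint Y'))) => //.
- exact: cylinders_setI.
- by move=> _; exact: cylindersT.
- by apply/seteqP; split => // x _; exists 0%N.
- move=> _ [A [mA ->]].
  transitivity (\prod_(i <- s) P (Y i @^-1` A i))%E.
    exact: (mutually_independent_seq indY).
  transitivity (\prod_(i <- s) P (Y' i @^-1` A i))%E; last first.
    exact/esym/(mutually_independent_seq indY').
  apply: eq_big_seq => i si; apply: YY' => //.
  exact: sD.
- by move=> _; rewrite -ge0_fin_numE//; exact: fin_num_measure.
Qed.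

End exchangeability.

(** * Probability bounds *)

Section probability_bounds.
Context {R : realType} {d : measure_display} {T : measurableType d}
  (P : probability T R).
Implicit Types A B : set T.

Local Notation pr A := (fine (P A)).

Lemma fine_probability_le A B : measurable A -> measurable B ->
  A `<=` B -> pr A <= pr B.
Proof.
move=> mA mB AB; apply: fine_le; rewrite ?fin_num_measure//.
by apply: le_measure; rewrite ?inE.
Qed.

Lemma fine_probabilityU A B : measurable A -> measurable B ->
  pr (A `|` B) = pr A + pr B - pr (A `&` B).
Proof.
move=> mA mB; rewrite measureUfinl//; last first.
  by rewrite -ge0_fin_numE// fin_num_measure.
have mAB : measurable (A `&` B) by exact: measurableI.
by rewrite fineB ?fineD// ?fin_numD ?fin_num_measure.
Qed.

Lemma fine_probabilityU_le A B : measurable A -> measurable B ->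
  pr (A `|` B) <= pr A + pr B.
Proof.
by move=> mA mB; rewrite fine_probabilityU// lerBlDr lerDl fine_ge0.
Qed.

Lemma union_bound (A : nat -> set T) (n : nat) (q : R) :
  (forall i, (i < n)%N -> measurable (A i)) ->
  (forall i, (i < n)%N -> pr (A i) <= q) ->
  pr (\big[setU/set0]_(i < n) A i) <= n%:R * q.
Proof.
elim: n => [_ _|n IH mA Aq]; first by rewrite big_ord0 measure0 mul0r.
rewrite big_ord_recr/= (le_trans (fine_probabilityU_le _ _))//.
- by apply: bigsetU_measurable => i _; exact/mA/ltnW/ltn_ord.
- exact: mA.
by rewrite -natr1 mulrDl mul1r lerD ?Aq// IH// => i /ltnW; [exact: mA|exact: Aq].
Qed.

(** Adding [A n] to the union of its predecessors loses only the mass of their overlap, at most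
    [n * q] by the union bound. The crude coefficient [n ^ 2] in place of [n (n - 1) / 2] costs only
    a constant factor. *)
Lemma bonferroni (A : nat -> set T) (n : nat) (p q : R) :
  (forall i, (i < n)%N -> measurable (A i)) ->
  (forall i, (i < n)%N -> p <= pr (A i)) ->
  (forall i j, (i < j < n)%N -> pr (A i `&` A j) <= q) ->
  0 <= q ->
  n%:R * p - n%:R ^+ 2 * q <= pr (\big[setU/set0]_(i < n) A i).
Proof.
move=> + + + q0; elim: n => [_ _ _|n IH mA Ap Aq].
  by rewrite big_ord0 measure0 expr2 !mul0r subr0.
have mU : measurable (\big[setU/set0]_(i < n) A i).
  by apply: bigsetU_measurable => i _; exact/mA/ltnW/ltn_ord.
have mAn : measurable (A n) by exact: mA.
rewrite big_ord_recr/= fine_probabilityU// big_distrl/=.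
(* The square grows by [n + (n + 1)]; the overlap uses up only the first summand. *)
have -> : n.+1%:R * p - n.+1%:R ^+ 2 * q =
    (n%:R * p - n%:R ^+ 2 * q) + p - (n%:R * q + (n%:R + 1) * q).
  by rewrite -natr1; ring.
apply: lerB.
  apply: lerD; last exact: Ap.
  apply: IH => [i /ltnW|i /ltnW|i j /andP[ij jn]]; [exact: mA|exact: Ap|].
  by apply: Aq; rewrite ij ltnW.
apply: (@le_trans _ _ (n%:R * q)); last by rewrite lerDl mulr_ge0// addr_ge0.
apply: (@union_bound (fun i => A i `&` A n)) => i ni.
  by apply: measurableI => //; exact/mA/ltnW.
by apply: Aq; rewrite ni/=.
Qed.

End probability_bounds.

(** * Markov's inequality for products of i.i.d. variables *)

Section independent_bounds.
Context {R : realType} {I : choiceType} {d : measure_display}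
  {T : measurableType d} (P : probability T R) (D : set I)
  (Y : I -> {RV P >-> R}) (X : {RV P >-> R}).
Hypothesis indY : mutually_independent D Y.
Hypothesis identY : forall i, D i -> identically_distributed (Y i) X.

Lemma markov_prod_independent (f : R -> R) (m u : R) (s : seq I) :
  measurable_fun setT f -> (forall x, 0 <= f x) ->
  (\int[P]_w (f (X w))%:E <= m%:E)%E -> 0 < u -> uniq s -> [set` s] `<=` D ->
  fine (P [set w | u <= \prod_(i <- s) f (Y i w)]) <= m ^+ size s / u.
Proof.
move=> mf f0 fm u0 us sD.
have fX0 : (0 <= \int[P]_w (f (X w))%:E)%E.
  by apply: integral_ge0 => w _; rewrite lee_fin.
have m0 : 0 <= m by rewrite -lee_fin (le_trans fX0).
have mg : measurable_fun setT (fun w => \prod_(i <- s) f (Y i w)).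
  by apply: measurable_prod => i _; exact: measurableT_comp.
set B := [set w | _].
have mB : measurable B.
  rewrite -[B]setTI; apply: (measurable_fun_le (f := cst u)) => //.
have g0 w : 0 <= \prod_(i <- s) f (Y i w) by apply: prodr_ge0.
rewrite ler_pdivlMr// -lee_fin EFinM fineK ?fin_num_measure//.
(* Markov's inequality: [u] times the indicator of [B] lies below the product pointwise. *)
have -> : (P B * u%:E = \int[P]_w (u%:E * (\1_B w)%:E))%E.
  rewrite ge0_integralZl ?lee_fin 1?ltW//; last exact/measurable_EFinP.
  by rewrite integral_indic// setIT muleC.
apply: (@le_trans _ _ (\int[P]_w (\prod_(i <- s) f (Y i w))%:E)%E).
  apply: ge0_le_integral => //.
  - by move=> w _; rewrite -EFinM lee_fin mulr_ge0//; exact: ltW.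
  - by apply/measurable_EFinP; apply: measurable_funM.
  - exact/measurable_EFinP.
  - move=> w _; rewrite -EFinM lee_fin indicE.
    have [|] := boolP (w \in B); rewrite ?mulr1 ?mulr0//.
    by rewrite inE.
rewrite (ge0_integral_prod_independent indY (f := fun=> f))//.
(* Each factor has the same integral as [f (X w)], by change of variables to the common law. *)
have E i : i \in s -> (\int[P]_w (f (Y i w))%:E = \int[P]_w (f (X w))%:E)%E.
  move=> si; have mF : measurable_fun setT (EFin \o f) by exact/measurable_EFinP.
  have F0 y : (0 <= (EFin \o f) y)%E by rewrite /= lee_fin.
  have := @ge0_integral_distribution _ _ _ _ _ P (Y i) _ mF F0; rewrite /comp => <-.
  have := @ge0_integral_distribution _ _ _ _ _ P X _ mF F0; rewrite /comp => <-.
  apply: eq_measure_integral => A mA _; apply: identY => //; exact: sD.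
rewrite (eq_big_seq _ E) big_const_seq count_predT.
elim: (size s) => [|k IH] /=; first by rewrite expr0.
by rewrite exprS EFinM; apply: lee_pmul => //; elim: k {IH} => //= k IH; exact: mule_ge0.
Qed.

End independent_bounds.

(** * The exponent for the Chernoff bound *)

Section lower_tail.
Context {R : realType} {d : measure_display} {T : measurableType d}
  (P : probability T R) (X : {RV P >-> R}).
Hypothesis EX2 : (\int[P]_w (X w ^+ 2)%:E = 1)%E.

(** If the transform equalled 1, then [X] would vanish almost surely, against [EX2]. Writing the
    exponent as [2 * c] leaves one [c] to be spent in the Chernoff bound. *)
Lemma laplace_transform_sqr_lt1 :
  exists2 c : R, 0 < c &
    (\int[P]_w (expR (- (X w ^+ 2)))%:E <= (expR (- (2 * c)))%:E)%E.
Proof.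
have me : measurable_fun setT (fun w => expR (- (X w ^+ 2))).
  apply: measurableT_comp => //; apply: measurableT_comp => //.
  exact: measurable_funX.
have e1 w : expR (- (X w ^+ 2)) <= 1 by rewrite -expR0 ler_expR oppr_le0 sqr_ge0.
have mf : measurable_fun setT (fun w => (1 - expR (- (X w ^+ 2)))%:E).
  by apply/measurable_EFinP; apply: measurable_funB.
set phi := (\int[P]_w _)%E.
have phi0 : (0 <= phi)%E by apply: integral_ge0 => w _; rewrite lee_fin expR_ge0.
have sum1 : (\int[P]_w (1 - expR (- (X w ^+ 2)))%:E + phi = 1)%E.
  rewrite -ge0_integralD//.
  - under eq_integral do rewrite -EFinD subrK.
    by rewrite integral_cst// mul1e; exact: probability_setT.
  - by move=> w _; rewrite lee_fin subr_ge0.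
  - exact/measurable_EFinP.
have phi_lt1 : (phi < 1)%E.
  rewrite lt_neqAle; apply/andP; split; last first.
    rewrite -sum1 leeDr//; apply: integral_ge0 => w _.
    by rewrite lee_fin subr_ge0.
  apply/eqP => phi_eq1.
  have int0 : (\int[P]_w (1 - expR (- (X w ^+ 2)))%:E = 0)%E.
    move: sum1; rewrite phi_eq1; case: (\int[P]_w _)%E => [r| |]// [r1].
    by congr EFin; lra.
  (* A nonnegative function with zero integral vanishes almost everywhere. *)
  have ae0 : ae_eq P setT (fun w => (1 - expR (- (X w ^+ 2)))%:E) (cst 0%E).
    apply/ae_eq_integral_abs => //; rewrite -[RHS]int0; apply: eq_integral => w _.
    by rewrite gee0_abs// lee_fin subr_ge0.
  have aeX : ae_eq P setT (fun w => (X w ^+ 2)%:E) (cst 0%E).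
    apply: filterS ae0 => w /(_ I) /= [] /eqP; rewrite subr_eq0 => /eqP e1'.
    move=> _; congr EFin; apply/eqP; rewrite -oppr_eq0; apply/eqP/(@expR_inj R).
    by rewrite expR0.
  have : (\int[P]_w (X w ^+ 2)%:E = 0)%E.
    rewrite (ae_eq_integral (cst 0%E) _ measurableT _ _ aeX)//; last first.
      by apply/measurable_EFinP; exact: measurable_funX.
    by rewrite integral0.
  by rewrite EX2 => /eqP; rewrite onee_eq0.
have phifin : phi \is a fin_num by rewrite ge0_fin_numE// (lt_trans phi_lt1)// ltry.
(* The floor 1/2 keeps [m] positive, so that its logarithm inverts [expR], and still below 1. *)
pose m := Num.max (fine phi) (2^-1).
have m0 : 0 < m by rewrite lt_max invr_gt0 ltr0n orbT.
have m1 : m < 1.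
  rewrite gt_max invf_lt1// ltr1n andbT.
  by rewrite -lte_fin fineK.
exists (- ln m / 2); first by rewrite divr_gt0// oppr_gt0 ln_lt0// m0.
rewrite -(fineK phifin) lee_fin (_ : - _ = ln m); last by field.
by rewrite lnK ?posrE// le_max lexx.
Qed.

End lower_tail.

Section independent_tails.
Context {R : realType} {I : choiceType} {d : measure_display}
  {T : measurableType d} (P : probability T R) (D : set I)
  (Y : I -> {RV P >-> R}) (X : {RV P >-> R}).
Hypothesis indY : mutually_independent D Y.
Hypothesis identY : forall i, D i -> identically_distributed (Y i) X.

(** Chernoff bound: with [n] the size of [s], Markov applied to the product of the [exp(-Y_i^2)] at
    level [exp(-c n)] gives [exp(-2 c n) / exp(-c n)]. *)
Lemma sum_sqr_lower_tail (c : R) (s : seq I) :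
  (\int[P]_w (expR (- (X w ^+ 2)))%:E <= (expR (- (2 * c)))%:E)%E ->
  uniq s -> [set` s] `<=` D ->
  fine (P [set w | \sum_(i <- s) Y i w ^+ 2 <= c * (size s)%:R]) <=
    expR (- (c * (size s)%:R)).
Proof.
move=> Xc us sD.
have mf : measurable_fun setT (fun x : R => expR (- (x ^+ 2))).
  apply: measurableT_comp => //; exact: measurableT_comp.
have := markov_prod_independent indY identY mf (fun=> expR_ge0 _) Xc
  (expR_gt0 (- (c * (size s)%:R))) us sD.
rewrite -expRM_natr -expRN -expRD.
rewrite (_ : _ + _ = - (c * (size s)%:R)); last by ring.
congr (fine (P _) <= _); apply/seteqP; split => w /=;
  by rewrite -expR_sum ler_expR sumrN lerN2.
Qed.

Lemma prod_sqr_upper_tail (u : R) (s : seq I) :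
  (\int[P]_w (X w ^+ 2)%:E = 1)%E -> 0 < u ->
  uniq s -> [set` s] `<=` D ->
  fine (P [set w | u <= \prod_(i <- s) Y i w ^+ 2]) <= u^-1.
Proof.
move=> EX2 u0 us sD.
have mf : measurable_fun setT (fun x : R => x ^+ 2).
  by apply: (@measurable_funX _ _ R setT id 2%N); exact: measurable_id.
have X1 : (\int[P]_w (X w ^+ 2)%:E <= 1%:E)%E by rewrite EX2.
have := markov_prod_independent indY identY mf (fun=> sqr_ge0 _) X1 u0 us sD.
by rewrite expr1n div1r.
Qed.

End independent_tails.

(** * The self-normalized products *)

Section self_normalized_ratio.
Context {R : realType}.
Implicit Types (n j : nat) (x : nat * nat -> R) (a : R).

(** A function of a deterministic array, so that one set of arrays can be pulled back along both the
    family and its row-permuted version. *)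
Definition column_norm n i x : R :=
  Num.sqrt (\sum_(1 <= k < n.+1) x (k, i) ^+ 2).

Definition self_normalized n j x : R :=
  n%:R `^ (4%:R^-1) * (`|x (j, 1%N) * x (j, 2%N)| /
    (column_norm n 1 x * column_norm n 2 x)).

(** Clears the division. A vanishing denominator makes the ratio 0, which cannot exceed [a > 0];
    hence the positivity conjunct. *)
Lemma self_normalized_gtE n j x a : 0 < a ->
  (a < self_normalized n j x) =
  (0 < column_norm n 1 x * column_norm n 2 x) &&
  (a * (column_norm n 1 x * column_norm n 2 x) <
   n%:R `^ (4%:R^-1) * `|x (j, 1%N) * x (j, 2%N)|).
Proof.
move=> a0; rewrite /self_normalized; set D := column_norm n 1 x * _.
have : 0 <= D by rewrite mulr_ge0 ?sqrtr_ge0.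
rewrite le_eqVlt => /predU1P[<-|D0].
  by rewrite ltxx invr0 !mulr0; apply/negbTE; rewrite -leNgt ltW.
by rewrite D0 mulrA ltr_pdivlMr.
Qed.

(** Measurability is asked only of the entries involved, because the lemma also serves on the
    cylinder space, where only the listed coordinates are known to be measurable. *)
Lemma measurable_self_normalized_gt d (T : measurableType d)
    (Z : nat * nat -> T -> R) n j a :
  0 < a -> (1 <= j <= n)%N ->
  (forall k i, (1 <= k <= n)%N -> i \in [:: 1; 2]%N ->
    measurable_fun setT (Z (k, i))) ->
  measurable [set w | a < self_normalized n j (Z ^~ w)].
Proof.
move=> a0 jn mZ.
have mnorm i : i \in [:: 1; 2]%N ->
    measurable_fun setT (fun w => column_norm n i (Z ^~ w)).
  move=> i12; apply: (measurableT_comp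
    (continuous_measurable_fun (@sqrt_continuous R))).
  (* Terms outside the range become 0, since measurability of the sum is derived from that of every
     term. *)
  apply: (eq_measurable_fun (fun w => \sum_(0 <= k < n)
      (if (k < n)%N then Z (k.+1, i) w else 0) ^+ 2)).
    by move=> w _; rewrite big_add1/=; apply: eq_big_nat => k /= ->.
  apply: measurable_sum => k; apply: measurable_funX.
  by case: (ltnP k n) => // kn; exact: mZ.
have mD : measurable_fun setT (fun w => column_norm n 1 (Z ^~ w) * column_norm n 2 (Z ^~ w)).
  by apply: measurable_funM; exact: mnorm.
have mN : measurable_fun setT (fun w => n%:R `^ (4%:R^-1) * `|Z (j, 1%N) w * Z (j, 2%N) w|).
  apply: measurable_funM => //; apply: measurableT_comp => //.
  by apply: measurable_funM; exact: mZ.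
have mlt : measurable_fun setT (fun w => a < self_normalized n j (Z ^~ w)).
  under eq_fun do rewrite self_normalized_gtE//.
  by apply: measurable_and; apply: measurable_fun_ltr => //; exact: measurable_funM.
by rewrite -[X in measurable X]setTI; exact: (mlt measurableT [set true]).
Qed.

(** Permuting the rows 1 to [n] leaves both column norms unchanged and only moves the numerator. *)
Lemma self_normalized_swap n j x (sw : nat -> nat) :
  involutive sw -> (forall k, (1 <= k <= n)%N -> (1 <= sw k <= n)%N) ->
  self_normalized n j (fun p => x (sw p.1, p.2)) = self_normalized n (sw j) x.
Proof.
move=> swK swn; rewrite /self_normalized /column_norm.
have E i : \sum_(1 <= k < n.+1) x (sw k, i) ^+ 2 = \sum_(1 <= k < n.+1) x (k, i) ^+ 2.
  rewrite -(big_map sw xpredT (fun k => x (k, i) ^+ 2)); apply: perm_big.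
  apply: uniq_perm; rewrite ?iota_uniq// ?map_inj_uniq ?iota_uniq//.
    exact: can_inj swK.
  move=> k; rewrite mem_index_iota ltnS; apply/mapP/idP => [[l + ->]|kn].
    by rewrite mem_index_iota ltnS; exact: swn.
  by exists (sw k); rewrite ?swK// mem_index_iota ltnS swn.
by rewrite /= !E.
Qed.

Lemma bigmax_self_normalized_gt n x a : 0 < a ->
  a < n%:R `^ (4%:R^-1) *
    ((\big[Num.max/0]_(1 <= j < n.+1) `|x (j, 1%N) * x (j, 2%N)|) /
     (column_norm n 1 x * column_norm n 2 x)) <->
  exists2 j, (j < n)%N & a < self_normalized n j.+1 x.
Proof.
move=> a0; rewrite /self_normalized.
set D := column_norm n 1 x * _; set K := n%:R `^ _.
(* If [D] or [K] is 0 (the latter when [n = 0]), both sides are false because [a > 0]. *)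
have [D0|D0] := eqVneq D 0.
  by rewrite D0 invr0 !mulr0; split => [/(lt_trans a0)|[j _]];
    rewrite ?mulr0 ?ltxx// => /(lt_trans a0); rewrite ltxx.
have {}D0 : 0 < D by rewrite lt_neqAle eq_sym D0 mulr_ge0 ?sqrtr_ge0.
have [K0|K0] := eqVneq K 0.
  by rewrite K0 !mul0r; split => [/(lt_trans a0)|[j _]];
    rewrite ?mul0r ?ltxx// => /(lt_trans a0); rewrite ltxx.
have {}K0 : 0 < K by rewrite lt_neqAle eq_sym K0 powR_ge0.
have E y : (a < K * (y / D)) = (a * D / K < y).
  by rewrite mulrA ltr_pdivlMr// ltr_pdivrMr// (mulrC y).
(* A nonnegative threshold cannot be exceeded by the default value 0 of the maximum. *)
have aDK0 : 0 <= a * D / K by apply: divr_ge0; [apply: mulr_ge0|]; exact: ltW.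
rewrite E big_add1 big_mkord/=; split => [/bigmax_gtP[|[j _ aj]]|[j jn]].
- by move=> /(le_lt_trans aDK0); rewrite ltxx.
- by exists j; rewrite ?E.
- by rewrite E => aj; apply/bigmax_gtP; right; exists (Ordinal jn).
Qed.

(** If both sums exceed [c n], so does the product of the norms, and each event gives
    [(a c n)^2 <= n^(1/2) x_{k,1}^2 x_{k,2}^2]. Multiplying the two and cancelling one [n] leaves
    [n^3]. *)
Lemma self_normalized_gt_pair n i j x (a c : R) : (0 < n)%N -> 0 < a -> 0 < c ->
  a < self_normalized n i x -> a < self_normalized n j x ->
  (exists2 l, l \in [:: 1; 2]%N & \sum_(1 <= k < n.+1) x (k, l) ^+ 2 <= c * n%:R) \/
  (a * c) ^+ 4 * n%:R ^+ 3 <=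
    x (i, 1%N) ^+ 2 * (x (i, 2%N) ^+ 2 * (x (j, 1%N) ^+ 2 * x (j, 2%N) ^+ 2)).
Proof.
move=> n0 a0 c0; rewrite !self_normalized_gtE// => /andP[D0 ai] /andP[_ aj].
have [S1|S1] := leP (\sum_(1 <= k < n.+1) x (k, 1%N) ^+ 2) (c * n%:R).
  by left; exists 1%N.
have [S2|S2] := leP (\sum_(1 <= k < n.+1) x (k, 2%N) ^+ 2) (c * n%:R).
  by left; exists 2%N.
right.
have n0R : 0 < n%:R :> R by rewrite ltr0n.
have cn0 : 0 <= c * n%:R by rewrite mulr_ge0// ltW.
set r := n%:R `^ 4^-1 in ai aj.
have r4 : r ^+ 4 = n%:R by rewrite -powR_mulrn ?powR_ge0// -powRrM mulVf// powRr1.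
have Dcn : c * n%:R <= column_norm n 1 x * column_norm n 2 x.
  rewrite -[leLHS](ger0_norm cn0) -sqrtr_sqr expr2 sqrtrM//.
  by apply: ler_pM; rewrite ?sqrtr_ge0// ler_wsqrtr// ltW.
have sqr_le k :
    a * (column_norm n 1 x * column_norm n 2 x) < r * `|x (k, 1%N) * x (k, 2%N)| ->
    (a * (c * n%:R)) ^+ 2 <= r ^+ 2 * (x (k, 1%N) ^+ 2 * x (k, 2%N) ^+ 2).
  move=> ak; rewrite -[x (k, 1%N) ^+ 2 * _]exprMn
    -(real_normK (num_real (x (k, 1%N) * x (k, 2%N)))) -exprMn.
  have aD : a * (c * n%:R) <= r * `|x (k, 1%N) * x (k, 2%N)|.
    by apply: le_trans (ltW ak); rewrite ler_pM2l.
  by apply: lerXn2r => //; rewrite nnegrE mulr_ge0 ?powR_ge0 ?(ltW a0).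
set xi := x (i, 1%N) ^+ 2; set yi := x (i, 2%N) ^+ 2.
set xj := x (j, 1%N) ^+ 2; set yj := x (j, 2%N) ^+ 2.
have : (a * (c * n%:R)) ^+ 2 * (a * (c * n%:R)) ^+ 2 <=
    r ^+ 2 * (xi * yi) * (r ^+ 2 * (xj * yj)).
  by apply: ler_pM; rewrite ?sqr_ge0//; exact: sqr_le.
rewrite (_ : _ * _ = n%:R * ((a * c) ^+ 4 * n%:R ^+ 3)); last by ring.
rewrite (_ : r ^+ 2 * _ * _ = n%:R * (xi * (yi * (xj * yj)))); last by rewrite -r4; ring.
by rewrite ler_pM2l.
Qed.

End self_normalized_ratio.

(** With [v = c n / 3], this is the cube of [v <= exp v]. *)
Lemma cube_expR_le {R : realType} (c : R) (n : nat) : 0 < c ->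
  n%:R ^+ 3 * expR (- (c * n%:R)) <= (3 / c) ^+ 3.
Proof.
move=> c0; rewrite expRN ler_pdivrMr ?expR_gt0//.
pose v : R := c * n%:R / 3.
have v0 : 0 <= v by rewrite divr_ge0// mulr_ge0// ltW.
have -> : n%:R = 3 / c * v by rewrite /v; field; rewrite gt_eqF.
have -> : c * (3 / c * v) = v * 3%:R by field; rewrite gt_eqF.
rewrite expRM_natr -exprMn.
apply: lerXn2r; rewrite ?nnegrE ?mulr_ge0 ?invr_ge0 ?expR_ge0 ?(ltW c0)//.
rewrite ler_pM2l ?divr_gt0//; apply: le_trans (expR_ge1Dx v).
by rewrite lerDr.
Qed.

(** * Single events and pairs of events in the double array *)

Section double_array.
Context {R : realType} {d : measure_display} {T : measurableType d}
  (P : probability T R) (X : {RV P >-> R}) (Y : nat * nat -> {RV P >-> R}).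
Let positive_indices : set (nat * nat) :=
  [set p : nat * nat | (1 <= p.1)%N /\ (1 <= p.2)%N].
Hypothesis indY : mutually_independent positive_indices Y.
Hypothesis identY : forall p, positive_indices p -> identically_distributed (Y p) X.
Hypothesis EX2 : (\int[P]_w (X w ^+ 2)%:E = 1)%E.

Let event (a : R) n j := [set w | a < self_normalized n j (Y ^~ w)].

Lemma measurable_event a n j : 0 < a -> (1 <= j <= n)%N -> measurable (event a n j).
Proof.
by move=> a0 jn; apply: measurable_self_normalized_gt.
Qed.

(** Transposing rows 1 and [j] preserves the joint law of the i.i.d. entries and carries one event
    to the other. *)
Lemma exchangeable_event a n j : 0 < a -> (1 <= j <= n)%N ->
  P (event a n j) = P (event a n 1).
Proof.
move=> a0 /andP[j1 jn].
(* The finitely many entries on which the events depend. *)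
pose s := [seq (k, i) | k <- index_iota 1 n.+1, i <- [:: 1; 2]%N].
have us : uniq s by apply: allpairs_uniq; rewrite ?iota_uniq// => -[? ?] [].
have sE k i : ((k, i) \in s) = (1 <= k <= n)%N && (i \in [:: 1; 2]%N).
  apply/allpairsP/andP => [[[k' i'] [/= + + [-> ->]]]|[kn i12]].
    by rewrite mem_index_iota ltnS.
  by exists (k, i); rewrite mem_index_iota ltnS.
have sD : [set` s] `<=` positive_indices.
  move=> [k i]; rewrite /= sE => /andP[/andP[k1 _]].
  by rewrite !inE => /orP[]/eqP ->.
pose sw k := if k == 1%N then j else if k == j then 1%N else k.
have swK : involutive sw.
  move=> k; rewrite /sw; case: (k =P 1%N) => [->|k1].
    by rewrite eqxx; case: eqP.
  case: (k =P j) => [->|kj]; first by rewrite eqxx.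
  by case: eqP k1 => //; case: eqP kj.
have swn k : (1 <= k <= n)%N -> (1 <= sw k <= n)%N.
  move=> kn; rewrite /sw; case: (k =P 1%N) => _; first by rewrite j1.
  by case: (k =P j) => _ //; exact: leq_trans jn.
pose tau (p : nat * nat) := (sw p.1, p.2).
have tauK : involutive tau by move=> [k i]; rewrite /tau/= swK.
have tauD p : positive_indices p -> positive_indices (tau p).
  by move=> [/= k1 i1]; split => //=; rewrite /sw; case: ifP => // _; case: ifP.
have Bm : measurable ([set x | a < self_normalized n 1 x] :
    set (g_sigma_algebraType (@cylinders R (nat * nat)%type s))).
  apply: (@measurable_self_normalized_gt _ _
    (g_sigma_algebraType (@cylinders R (nat * nat)%type s)) (fun p x => x p)) => //.
    exact: leq_trans jn.
  by move=> k i kn i12; apply: measurable_coord; rewrite sE kn.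
rewrite [RHS](eq_joint_distribution indY
  (mutually_independent_comp_involutive tauK tauD indY) _ us sD Bm); last first.
  move=> p A pD mA; have := identY pD mA; rewrite /distribution/= /pushforward => ->.
  by have := identY (tauD p pD) mA; rewrite /distribution/= /pushforward => ->.
congr (P _); apply/seteqP; split => w /=;
  by rewrite (@self_normalized_swap _ n 1 (Y ^~ w) sw swK swn) /sw eqxx.
Qed.

(** Each of the two columns contributes one Chernoff term; the last term is Markov for the product
    of four squared entries. *)
Lemma pair_event_bound (a c : R) n i j : 0 < a -> 0 < c ->
  (\int[P]_w (expR (- (X w ^+ 2)))%:E <= (expR (- (2 * c)))%:E)%E ->
  (1 <= i < j)%N -> (j <= n)%N ->
  fine (P (event a n i `&` event a n j)) <=
  2 * expR (- (c * n%:R)) + ((a * c) ^+ 4 * n%:R ^+ 3)^-1.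
Proof.
move=> a0 c0 Xc /andP[i1 ij] jn.
have n0 : (0 < n)%N by rewrite (leq_trans _ jn)// (leq_trans _ ij).
pose col l := [set w | \sum_(1 <= k < n.+1) Y (k, l) w ^+ 2 <= c * n%:R].
(* These positions are distinct because [i < j], so the entries are independent. *)
pose s := [:: (i, 1); (i, 2); (j, 1); (j, 2)]%N.
pose u := (a * c) ^+ 4 * n%:R ^+ 3.
pose B := [set w | u <= \prod_(p <- s) Y p w ^+ 2].
have mY p : measurable_fun setT (Y p : T -> R) by exact: measurable_funPT.
have mcol l : measurable (col l).
  rewrite -[col l]setTI; apply: measurable_fun_le => //.
  by apply: measurable_sum => k; exact: measurable_funX.
have mB : measurable B.
  rewrite -[B]setTI; apply: measurable_fun_le => //.
  by apply: measurable_prod => k _; exact: measurable_funX.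
have colP l : l \in [:: 1; 2]%N -> fine (P (col l)) <= expR (- (c * n%:R)).
  move=> l12; pose cl := [seq (k, l) | k <- index_iota 1 n.+1].
  have szc : size cl = n by rewrite size_map size_iota subn1.
  have uc : uniq cl by rewrite map_inj_uniq ?iota_uniq// => ? ? [].
  have cD : [set` cl] `<=` positive_indices.
    move=> _ /mapP[k + ->]; rewrite mem_index_iota => /andP[k1 _]; split => //=.
    by move: l12; rewrite !inE => /orP[]/eqP ->.
  have := sum_sqr_lower_tail indY identY Xc uc cD; rewrite szc.
  by congr (fine (P _) <= _); apply/seteqP; split => w /=; rewrite big_map.
have BP : fine (P B) <= u^-1.
  apply: (prod_sqr_upper_tail indY identY EX2) => //.
  - by rewrite mulr_gt0// exprn_gt0// ?mulr_gt0// ltr0n.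
  - by rewrite /= !inE !xpair_eqE /= !andbF !andbT /= (ltn_eqF ij).
  - have j1 : (1 <= j)%N by rewrite (leq_trans i1)// ltnW.
    by move=> p /=; rewrite !inE => /or4P[]/eqP ->.
have sub : event a n i `&` event a n j `<=` (col 1%N `|` col 2%N) `|` B.
  move=> w [ai aj].
  have [[l + Sl]|Bw] := self_normalized_gt_pair n0 a0 c0 ai aj.
    by rewrite !inE => /orP[]/eqP El; left; [left|right]; rewrite El in Sl.
  by right; rewrite /B /= !big_cons big_nil mulr1.
have jn' : (1 <= j <= n)%N by rewrite jn (leq_trans i1)// ltnW.
have in' : (1 <= i <= n)%N by rewrite i1 (leq_trans (ltnW ij)).
apply: (le_trans (fine_probability_le P _ _ sub)).
- by apply: measurableI; exact: measurable_event.
- by apply: measurableU => //; exact: measurableU.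
apply: (le_trans (fine_probabilityU_le P _ mB)); first exact: measurableU.
apply: lerD => //; apply: (le_trans (fine_probabilityU_le P _ _)) => //.
by rewrite mulr_natl mulr2n lerD// colP.
Qed.

End double_array.

(** * Boundedness and the equivalence *)

Lemma eqO_cst1P {R : realType} (f : nat -> R) : (forall n, 0 <= f n) ->
  (f =O_\oo (fun=> 1 : R)) <-> exists M, \forall n \near \oo, f n <= M.
Proof.
move=> f0; rewrite eqO_exP; split => [[M M0 fM]|[M fM]].
  by exists M; apply: filterS fM => n; rewrite normr1 mulr1 ger0_norm.
(* The Landau constant must be positive, which [M] need not be. *)
exists (Num.max M 1); first by rewrite lt_max ltr01 orbT.
apply: filterS fM => n fnM; rewrite normr1 mulr1 ger0_norm//.
by rewrite le_max fnM.
Qed.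

Theorem lemma2p6 (R : realType) (d : measure_display) (T : measurableType d)
    (P : probability T R) (X : {RV P >-> R}) (Xs : nat -> nat -> {RV P >-> R})
    (hindep : mutually_independent
       [set p : nat * nat | (1 <= p.1)%N /\ (1 <= p.2)%N]
       (fun p : nat * nat => Xs p.1 p.2))
    (hident : forall k i : nat, (1 <= k)%N -> (1 <= i)%N ->
       identically_distributed (Xs k i) X)
    (hX2 : ('E_P[fun w => (X w ^+ 2)%R] = 1)%E)
    (a : R) (ha : 0 < a) :
  ((fun n : nat => n%:R *
      fine (P [set w | a < n%:R `^ (4%:R^-1) *
        ((\big[Num.max/0]_(1 <= j < n.+1) `|Xs j 1%N w * Xs j 2%N w|) /
         (Num.sqrt (\sum_(1 <= k < n.+1) Xs k 1%N w ^+ 2) *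
          Num.sqrt (\sum_(1 <= k < n.+1) Xs k 2%N w ^+ 2)))]) : R)
    =O_\oo (fun=> 1 : R))
  <->
  ((fun n : nat => n%:R ^+ 2 *
      fine (P [set w | a < n%:R `^ (4%:R^-1) *
        (`|Xs 1%N 1%N w * Xs 1%N 2%N w| /
         (Num.sqrt (\sum_(1 <= k < n.+1) Xs k 1%N w ^+ 2) *
          Num.sqrt (\sum_(1 <= k < n.+1) Xs k 2%N w ^+ 2)))]) : R)
    =O_\oo (fun=> 1 : R)).
Proof.
pose Y p := Xs p.1 p.2.
have identY p : [set p : nat * nat | (1 <= p.1)%N /\ (1 <= p.2)%N] p ->
  identically_distributed (Y p) X by move=> [? ?]; exact: hident.
have EX2 : (\int[P]_w (X w ^+ 2)%:E = 1)%E by rewrite -hX2 unlock.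
have [c c0 Xc] := laplace_transform_sqr_lt1 EX2.
pose event n j := [set w | a < self_normalized n j (Y ^~ w)].
pose p n := fine (P (event n 1%N)).
pose q n := 2 * expR (- (c * n%:R)) + ((a * c) ^+ 4 * n%:R ^+ 3)^-1.
(* Rows are numbered from 1 and the union from 0, hence [j.+1]. *)
pose U n := \big[setU/set0]_(j < n) event n j.+1.
have q0 n : 0 <= q n.
  by rewrite addr_ge0 ?invr_ge0 ?mulr_ge0 ?exprn_ge0 ?expR_ge0// ltW.
have mE n j : (j < n)%N -> measurable (event n j.+1).
  by move=> jn; exact: measurable_event.
have pE n j : (j < n)%N -> fine (P (event n j.+1)) = p n.
  by move=> jn; rewrite /p (exchangeable_event hindep identY).
have lower n : n%:R * p n - n%:R ^+ 2 * q n <= fine (P (U n)).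
  apply: (bonferroni (mE n)) => // [j jn|i j /andP[ij jn]]; first by rewrite pE.
  exact: (pair_event_bound hindep identY EX2).
have upper n : fine (P (U n)) <= n%:R * p n.
  by apply: (union_bound (mE n)) => j jn; rewrite pE.
have cube_q n : n%:R ^+ 3 * q n <= 2 * (3 / c) ^+ 3 + ((a * c) ^+ 4)^-1.
  rewrite mulrDr lerD//.
    by rewrite mulrCA ler_pM2l// cube_expR_le.
  (* At [n = 0] the factor [n^3] does not cancel its inverse, but the left side is 0. *)
  have [->|n0] := posnP n.
    by rewrite expr0n mul0r invr_ge0 exprn_ge0// mulr_ge0// ltW.
  by rewrite invfM mulrCA divff ?mulr1// expf_neq0// pnatr_eq0 -lt0n.
have maxE n : [set w | a < n%:R `^ (4%:R^-1) *
        ((\big[Num.max/0]_(1 <= j < n.+1) `|Xs j 1%N w * Xs j 2%N w|) /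
         (Num.sqrt (\sum_(1 <= k < n.+1) Xs k 1%N w ^+ 2) *
          Num.sqrt (\sum_(1 <= k < n.+1) Xs k 2%N w ^+ 2)))] = U n.
  rewrite /U -(bigcup_mkord n (fun j => event n j.+1)).
  apply/seteqP; split => w.
    by move=> /(bigmax_self_normalized_gt n (Y ^~ w) ha)[j jn aj]; exists j.
  by move=> [j jn aj]; apply/(bigmax_self_normalized_gt n (Y ^~ w) ha); exists j.
under [X in X =O_\oo _ <-> _]eq_fun do rewrite maxE.
change ((fun n => n%:R * fine (P (U n)) : R) =O_\oo (fun=> 1 : R) <->
  (fun n => n%:R ^+ 2 * p n : R) =O_\oo (fun=> 1 : R)).
rewrite !eqO_cst1P; last 2 first.
- by move=> n; rewrite mulr_ge0// fine_ge0.
- by move=> n; rewrite mulr_ge0// fine_ge0.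
split=> -[M bM].
  (* Bonferroni multiplied by [n] gives [n^2 p <= n P(U) + n^3 q], and [cube_q] bounds the last term
     uniformly in [n]. *)
  exists (M + (2 * (3 / c) ^+ 3 + ((a * c) ^+ 4)^-1)); apply: filterS bM => n bM.
  apply: le_trans (lerD bM (cube_q n)).
  rewrite -lerBlDr [leLHS](_ : _ = n%:R * (n%:R * p n - n%:R ^+ 2 * q n)); last by ring.
  by rewrite ler_wpM2l.
(* The converse is the union bound multiplied by [n]. *)
exists M; apply: filterS bM => n; apply: le_trans.
by rewrite expr2 -mulrA ler_wpM2l.
Qed.
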